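(* Let $s\ge 2$. For every $j=1,\ldots,s$, let $(\eta^{(j)}_i)_{i\ge 0}$ be the sequence defined by $$\eta^{(j)}_i=\exp\Big(\mathrm{i}\pi\sum_{l=0}^{t}b_l2^{-l}\Big)\quad\text{where } i=\sum_{l=0}^{t}b_l2^l,\ b_l\in\{0,1\}$$ (here $\mathrm{i}$ in the exponential is the imaginary unit). Then the intertwining sequence of $(\eta^{(1)}_i)_{i\ge0},\ldots,(\eta^{(s)}_i)_{i\ge0}$ is a Leja sequence for the closed unit polydisc $\overline{\mathbb{D}}^s$, where $\overline{\mathbb{D}}=\{z\in\mathbb{C}:|z|\le 1\}$.
   Context: Numeration of $\mathbb{N}^s$ ($\mathbb{N}=\{0,1,2,\ldots\}$): for $k=(k_1,\ldots,k_s)\in\mathbb{N}^s$ put $|k|=k_1+\cdots+k_s$. Order $\mathbb{N}^s$ by: $k\le l$ iff $|k|<|l|$, or $|k|=|l|$ and $k\le l$ in the lexicographic order (where $k<l$ lexicographically iff $k_1<l_1$, or $k_1=l_1,\ldots,k_t=l_t$ and $k_{t+1}<l_{t+1}$ for some $1\le t\le s-1$). Let $n\mapsto k(n)=(k_1(n),\ldots,k_s(n))$, $n\ge 1$, be the increasing enumeration of $\mathbb{N}^s$ for this order; e.g. for $s=3$: $k(1)=(0,0,0)$, $k(2)=(0,0,1)$, $k(3)=(0,1,0)$, $k(4)=(1,0,0)$, $k(5)=(0,0,2)$, $k(6)=(0,1,1),\ldots$ Intertwining sequence: given complex sequences $(\eta^{(j)}_i)_{i\ge0}$, $j=1,\ldots,s$,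 their intertwining sequence is $H_n=\eta_{k(n)}:=(\eta^{(1)}_{k_1(n)},\ldots,\eta^{(s)}_{k_s(n)})\in\mathbb{C}^s$, $n\ge 1$. Vandermonde determinant: let $e_n(z)=z_1^{k_1(n)}\cdots z_s^{k_s(n)}$, $n\ge1$. For $H_1,\ldots,H_N\in\mathbb{C}^s$, $\mathrm{VDM}(H_1,\ldots,H_N)=\det[e_i(H_j)]_{1\le i,j\le N}$. Multidimensional Leja sequence: a Leja sequence for a compact set $K\subset\mathbb{C}^s$ is a sequence $(H_n)_{n\ge 1}$ of elements of $K$ with $H_1\in\partial K$ and, for all $N\ge 1$, $|\mathrm{VDM}(H_1,\ldots,H_N,H_{N+1})|=\sup_{z\in K}|\mathrm{VDM}(H_1,\ldots,H_N,z)|$. *)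

(* Defs.v *)
From mathcomp Require Import all_boot all_order all_algebra.
From mathcomp Require Import all_classical all_reals all_analysis.
From mathcomp Require Import complex.
Set Implicit Arguments.
Unset Strict Implicit.
Unset Printing Implicit Defensive.
Import Order.TTheory GRing.Theory Num.Theory.
Import numFieldNormedType.Exports.

Local Open Scope classical_set_scope.
Local Open Scope ring_scope.

(* [R[i]] seen through its [numClosedFieldType] structure: this is what makes
   the norm topology on scalars and on ['rV_s] available. *)
Definition Cplx (R : realType) : numClosedFieldType := R[i]%C.

Definition cabs (R : realType) (z : Cplx R) : R := ComplexField.Normc.normc z.

Definition cexp (R : realType) (z : Cplx R) : Cplx R :=
  ((expR (complex.Re z))%:C * (cos (complex.Im z) +i* sin (complex.Im z)))%C.

Definition grlex (s : nat) (k l : s.-tuple nat) : bool :=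
  (sumn k < sumn l)%N ||
  ((sumn k == sumn l) && ((k : s.-tuplelexi nat) <= (l : s.-tuplelexi nat))%O).

Definition multis_upto (s n : nat) : seq (s.-tuple nat) :=
  [seq k : s.-tuple nat <- [seq map_tuple val t | t : s.-tuple 'I_n.+1] | (sumn k <= n)%N].

(* The increasing enumeration of N^s, shifted to start at 0.  For [0 < s] the
   multi-indices of total degree at most [n] are an initial segment of N^s with
   more than [n] elements, so its [n]-th element does not depend on the
   truncation; see [multi_mono] and [multi_surj]. *)
Definition multi (s n : nat) : s.-tuple nat :=
  nth (nseq_tuple s 0%N) (sort (@grlex s) (multis_upto s n)) n.

Definition intertwining (R : realType) (s : nat) (eta : 'I_s -> nat -> Cplx R)
    (n : nat) : 'rV[Cplx R]_s :=
  \row_(j < s) eta j (tnth (multi s n) j).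

Definition monom (R : realType) (s n : nat) (z : 'rV[Cplx R]_s) : Cplx R :=
  \prod_(j < s) z 0 j ^+ tnth (multi s n) j.

Definition VDM (R : realType) (s N : nat) (P : 'I_N -> 'rV[Cplx R]_s) : Cplx R :=
  \det (\matrix_(i < N, j < N) monom i (P j)).

Definition boundary (T : topologicalType) (K : set T) : set T :=
  closure K `\` interior K.

(* [H n] is the (n+1)-st term of the sequence.  The supremum is taken in the
   extended reals, hence is the true one whatever [K] is. *)
Definition is_leja (R : realType) (s : nat) (K : set 'rV[Cplx R]_s)
    (H : nat -> 'rV[Cplx R]_s) : Prop :=
  [/\ forall n, K (H n),
      boundary K (H 0%N) &
      forall N : nat, (1 <= N)%N ->
        (cabs (VDM (fun j : 'I_N.+1 => H j)))%:E =
        ereal_sup [set (cabs (VDM (fun j : 'I_N.+1 =>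
                          if (j < N)%N then H j else z)))%:E | z in K]].

Definition closed_polydisc (R : realType) (s : nat) : set 'rV[Cplx R]_s :=
  [set z | forall j, cabs (z 0 j) <= 1].

Definition bit (i l : nat) : bool := odd (i %/ 2 ^ l).

(* All binary digits of [i] of rank greater than [i] vanish; [binary_leja_digits]
   gives the value for an arbitrary binary expansion. *)
Definition binary_leja (R : realType) (i : nat) : Cplx R :=
  cexp ('i%C * (pi * \sum_(l < i.+1) (bit i l)%:R * 2 ^- l)%:C%C).

Section Grlex.
Variable s : nat.

Lemma grlex_total : total (@grlex s).
Proof.
move=> k l; rewrite /grlex [sumn l == _]eq_sym.
by case: (ltngtP (sumn k) (sumn l)) => //= _; exact: le_total.
Qed.

Lemma grlex_trans : transitive (@grlex s).
Proof.
move=> l k m /orP[kl|/andP[/eqP kl kl']] /orP[lm|/andP[/eqP lm lm']];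
  rewrite /grlex.
- by rewrite (ltn_trans kl lm).
- by rewrite -lm kl.
- by rewrite kl lm.
- by rewrite kl lm eqxx (le_trans kl' lm') orbT.
Qed.

Lemma grlex_anti : antisymmetric (@grlex s).
Proof.
move=> k l; rewrite /grlex [sumn l == _]eq_sym.
by case: (ltngtP (sumn k) (sumn l)) => //= _ /le_anti.
Qed.

Lemma mem_multis_upto n (k : s.-tuple nat) :
  (k \in multis_upto s n) = (sumn k <= n)%N.
Proof.
rewrite mem_filter; case: leqP => //= kn.
have lt_k i : (tnth k i < n.+1)%N.
  apply: leq_trans kn; rewrite sumnE big_tuple (bigD1 i) //=.
  exact: leq_addr.
apply/mapP; exists [tuple Ordinal (lt_k i) | i < s]; rewrite ?mem_enum //.
by apply: eq_from_tnth => i; rewrite tnth_map tnth_mktuple.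
Qed.

Let L n := sort (@grlex s) (multis_upto s n).

Lemma mem_L n k : (k \in L n) = (sumn k <= n)%N.
Proof. by rewrite mem_sort mem_multis_upto. Qed.

Lemma uniq_L n : uniq (L n).
Proof.
rewrite sort_uniq filter_uniq// map_inj_uniq ?enum_uniq// => t u tu.
apply: eq_from_tnth => i; apply: val_inj.
by have := congr1 (fun v => tnth v i) tu; rewrite !tnth_map.
Qed.

Lemma pairwise_L n : pairwise (@grlex s) (L n).
Proof.
by rewrite -(sorted_pairwise grlex_trans); exact: sort_sorted grlex_total _.
Qed.

Lemma prefix_L m n : (m <= n)%N ->
  L n = L m ++ [seq k : s.-tuple nat <- L n | (m < sumn k)%N].
Proof.
move=> mn; apply: (sorted_eq grlex_trans grlex_anti).
- exact: sort_sorted grlex_total _.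
- rewrite (sorted_pairwise grlex_trans) pairwise_cat pairwise_L.
  rewrite (pairwise_filter _ (pairwise_L n)) !andbT.
  apply/allrelP => k l; rewrite mem_L mem_filter => km /andP[ml _].
  by rewrite /grlex (leq_ltn_trans km ml).
- apply: uniq_perm; first exact: uniq_L.
    rewrite cat_uniq uniq_L filter_uniq ?uniq_L// andbT /=.
    apply/hasPn => k; rewrite mem_filter !mem_L => /andP[mk _].
    by rewrite -ltnNge.
  move=> k; rewrite mem_cat mem_filter !mem_L.
  by case: leqP => //= km; exact: leq_trans km mn.
Qed.

Hypothesis s_gt0 : (0 < s)%N.

Lemma size_L n : (n < size (L n))%N.
Proof.
pose i0 := Ordinal s_gt0.
pose f (i : nat) : s.-tuple nat := [tuple if j == i0 then i else 0%N | j < s].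
rewrite -[n.+1](size_iota 0) -(size_map f); apply: uniq_leq_size.
  rewrite map_inj_uniq ?iota_uniq// => i i' /(congr1 (fun v => tnth v i0)).
  by rewrite !tnth_mktuple eqxx.
move=> _ /mapP[i + ->]; rewrite mem_iota /= add0n ltnS mem_L => iN.
rewrite sumnE big_tuple (bigD1 i0)//= tnth_mktuple eqxx big1 ?addn0// => j ji0.
by rewrite tnth_mktuple (negbTE ji0).
Qed.

Lemma multiE m n : (m <= n)%N -> multi s m = nth (nseq_tuple s 0%N) (L n) m.
Proof. by move=> mn; rewrite (prefix_L mn) nth_cat size_L. Qed.

Lemma multi_mono : {mono multi s : m n / (m <= n)%N >-> grlex m n}.
Proof.
have le_multi m n : (m <= n)%N -> grlex (multi s m) (multi s n).
  move=> mn; rewrite (multiE mn) (multiE (leqnn n)).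
  apply: (sorted_leq_nth grlex_trans) => //.
  - by move=> k; rewrite /grlex eqxx lexx orbT.
  - exact: sort_sorted grlex_total _.
  - by rewrite inE (leq_ltn_trans mn (size_L n)).
  - by rewrite inE size_L.
move=> m n; case: (leqP m n) => [|nm]; first exact: le_multi.
apply/negbTE/negP => mn.
have : multi s m = multi s n by apply: grlex_anti; rewrite mn le_multi // ltnW.
rewrite (multiE (ltnW nm)) (multiE (leqnn m)) => /eqP.
by rewrite nth_uniq ?uniq_L ?size_L ?(ltn_trans nm (size_L m))// gtn_eqF.
Qed.

Lemma multi_surj (k : s.-tuple nat) : exists n, multi s n = k.
Proof.
have kL : k \in L (sumn k) by rewrite mem_L.
exists (index k (L (sumn k))); set j := index _ _.
rewrite (multiE (leq_maxl j (sumn k))) (prefix_L (leq_maxr j (sumn k))).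
by rewrite nth_cat index_mem kL nth_index.
Qed.

End Grlex.

Lemma bit_digits (t : nat) (b : nat -> bool) (l : nat) :
  bit (\sum_(m < t) b m * 2 ^ m) l = (l < t)%N && b l.
Proof.
elim: t b l => [|t IH] b l; first by rewrite big_ord0 /bit div0n.
rewrite big_ord_recl /= muln1.
have -> : (\sum_(i < t) b (bump 0 i) * 2 ^ bump 0 i =
           2 * \sum_(i < t) b i.+1 * 2 ^ i)%N.
  by rewrite big_distrr /=; apply: eq_bigr => i _; rewrite expnS mulnCA.
case: l => [|l].
  by rewrite /bit expn0 divn1 oddD oddM addbF oddb.
have half (c : bool) (x : nat) : ((c + 2 * x) %/ 2 = x)%N.
  by rewrite mulnC divnDMl // divn_small // ltnS leq_b1.
rewrite /bit expnS divnMA half.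
exact: (IH (b \o S)).
Qed.

Lemma sum_extend (V : nmodType) (n N : nat) (F : nat -> V) : (n <= N)%N ->
  (forall l, (n <= l)%N -> F l = 0) -> \sum_(l < n) F l = \sum_(l < N) F l.
Proof.
move=> nN F0; rewrite (big_ord_widen N F nN).
rewrite [RHS](bigID (fun l : 'I_N => (l < n)%N)) /=.
by rewrite [X in _ = _ + X]big1 ?addr0// => l; rewrite -leqNgt => /F0.
Qed.

Lemma binary_leja_digits (R : realType) (t : nat) (b : nat -> bool) :
  binary_leja R (\sum_(l < t.+1) b l * 2 ^ l)%N =
  cexp ('i%C * (pi * \sum_(l < t.+1) (b l)%:R * 2 ^- l)%:C%C).
Proof.
rewrite /binary_leja; set i := (\sum_(l < _) _)%N.
congr (cexp ('i%C * (pi * _)%:C%C)).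
rewrite (@sum_extend _ i.+1 (maxn i.+1 t.+1) (fun l => (bit i l)%:R * 2 ^- l)).
- rewrite -(@sum_extend _ t.+1 _ (fun l => (bit i l)%:R * 2 ^- l)) ?leq_maxr//.
    by apply: eq_bigr => l _; rewrite bit_digits ltn_ord.
  by move=> l tl; rewrite bit_digits ltnNge tl mul0r.
- exact: leq_maxl.
- move=> l il; rewrite /bit divn_small ?mul0r//.
  exact: ltn_trans il (ltn_expl _ _).
Qed.

(* Main.v *)
(** Let [k = multi s N].  The polynomial
    [Q z = prod_j prod_(i < k_j) (z_j - eta^(j)_i)] has leading monomial [z^k],
    its other monomials being smaller, and it vanishes at the first [N]
    intertwined points, because a multi-index preceding [k] is smaller than [k]
    in some coordinate.  Hence [VDM (H_0, ..., H_(N-1), z)] is a constant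
    times [Q z], and it suffices that each one-variable sequence be a Leja
    sequence for the disc.  For [P_k z = prod_(i < k) (z - eta_i)] this follows
    by binary induction: [eta_(2i) ^ 2 = eta_i] and [eta_(2i+1) = - eta_(2i)]
    give [P_(2m) z = P_m (z ^ 2)] and
    [P_(2m+1) z = P_m (z ^ 2) * (z - eta_(2m))]. *)
Require Import Defs.
From mathcomp Require Import all_boot all_order all_algebra.
From mathcomp Require Import all_classical all_reals all_analysis.
From mathcomp Require Import complex.
From mathcomp Require Import zify ring lra.
Set Implicit Arguments.
Unset Strict Implicit.
Unset Printing Implicit Defensive.
Import Order.TTheory GRing.Theory Num.Theory.
Import numFieldNormedType.Exports.

Local Open Scope classical_set_scope.
Local Open Scope ring_scope.

Lemma grlex_pointwise (s : nat) (k l : s.-tuple nat) :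
  (forall j, tnth k j <= tnth l j)%N -> grlex k l.
Proof.
move=> kl; rewrite /grlex; case: (ltnP (sumn k) (sumn l)) => //= lk.
suff -> : k = l by rewrite eqxx lexx.
have sum_kl : (\sum_(j < s) tnth k j <= \sum_(j < s) tnth l j ?= iff
               [forall j, tnth k j == tnth l j])%N.
  by apply: leqif_sum => j _; split => //; exact: kl.
have : (\sum_(j < s) tnth k j == \sum_(j < s) tnth l j)%N.
  rewrite eqn_leq; apply/andP; split; first exact: sum_kl.1.
  by move: lk; rewrite !sumnE !big_tuple.
by rewrite sum_kl.2 => /forallP kl_eq; apply: eq_from_tnth => j; apply/eqP.
Qed.

Section Intertwining.
Variables (R : realType) (s : nat).
Hypothesis s_gt0 : (0 < s)%N.

(** Entry [(i, ord_max)] of [A *m \adj A = (\det A)%:M]: pairing the last-row cofactors with another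
    row gives 0. *)
Lemma sum_monom_cofactor (N : nat) (P : 'I_N.+1 -> 'rV[Cplx R]_s) (i : 'I_N.+1) :
  \sum_j monom i (P j) *
     cofactor (\matrix_(a < N.+1, b < N.+1) monom a (P b)) ord_max j =
  VDM P *+ (i == ord_max).
Proof.
rewrite /VDM; set A := \matrix_(_, _) _.
have /matrixP/(_ i ord_max) := mul_mx_adj A.
by rewrite !mxE => <-; apply: eq_bigr => j _; rewrite !mxE.
Qed.

Variable eta : 'I_s -> nat -> Cplx R.

Definition newton (k : s.-tuple nat) (z : 'rV[Cplx R]_s) : Cplx R :=
  \prod_(j < s) \prod_(i < tnth k j) (z 0 j - eta j i).

Lemma newton_intertwining (N m : nat) : (m < N)%N ->
  newton (multi s N) (intertwining eta m) = 0.
Proof.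
move=> mN; have [/forallP kNm|] :=
    boolP [forall j, tnth (multi s N) j <= tnth (multi s m) j]%N.
  by move/grlex_pointwise: kNm; rewrite (multi_mono s_gt0) leqNgt mN.
rewrite negb_forall => /existsP[j]; rewrite -ltnNge => jmN.
rewrite /newton (bigD1 j)//= (bigD1 (Ordinal jmN))//=.
by rewrite mxE subrr !mul0r.
Qed.

(* Laplace expansion after replacing the last row of the Vandermonde matrix by
   the values of [newton (multi s N)], which is [monom N] plus a combination of
   the previous monomials. *)
Lemma sum_newton_cofactor (N : nat) (P : 'I_N.+1 -> 'rV[Cplx R]_s) :
  \sum_j newton (multi s N) (P j) *
     cofactor (\matrix_(a < N.+1, b < N.+1) monom a (P b)) ord_max j = VDM P.
Proof.
set k := multi s N; set cof := cofactor _ _.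
pose p j : {poly Cplx R} := \prod_(i < tnth k j) ('X - (eta j i)%:P).
have size_p j : size (p j) = (tnth k j).+1.
  by rewrite /p size_prod_XsubC [index_enum _]unlock -enumT size_enum_ord.
have monic_p j : p j \is monic by exact: monic_prod_XsubC.
(* A common bound on the exponents, so that the product over [j] of sums becomes a sum over
   functions into one finite type. *)
have kB j : (tnth k j < (sumn k).+1)%N.
  by rewrite ltnS sumnE big_tuple (bigD1 j)//= leq_addr.
have newtonE z : newton k z = \sum_(f : {ffun 'I_s -> 'I_(sumn k).+1})
    (\prod_j (p j)`_(f j)) * \prod_j z 0 j ^+ f j.
  rewrite /newton.
  have -> : \prod_(j < s) \prod_(i < tnth k j) (z 0 j - eta j i) =
            \prod_(j < s) \sum_(i < (sumn k).+1) (p j)`_i * z 0 j ^+ i.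
    apply: eq_bigr => j _; rewrite -horner_coef_wide ?size_p//.
    by rewrite horner_prod; apply: eq_bigr => i _; rewrite !hornerE.
  by rewrite bigA_distr_bigA /=; apply: eq_bigr => f _; rewrite big_split.
under eq_bigr do rewrite newtonE mulr_suml.
rewrite exchange_big /=.
pose f0 : {ffun 'I_s -> 'I_(sumn k).+1} := [ffun j => Ordinal (kB j)].
(* [f0] is [k] itself: as each [p j] is monic, its term is the expansion of [VDM P] along the last
   row. All other terms vanish. *)
rewrite (bigD1 f0)//= [X in _ + X]big1 ?addr0 => [|f ff0].
  transitivity (VDM P *+ (ord_max == ord_max :> 'I_N.+1)); last first.
    by rewrite eqxx.
  rewrite -sum_monom_cofactor; apply: eq_bigr => j _; rewrite big1 => [|i _].
    rewrite mul1r; congr (_ * _).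
    by apply: eq_bigr => i _; rewrite ffunE.
  by rewrite ffunE /= -(monicP (monic_p i)) lead_coefE size_p.
(* Either some [f j] exceeds the degree of [p j] and the coefficient is 0, or [f] is [multi s n]
   with [n < N] and its cofactor sum is 0. *)
have [/forallP fk|] := boolP [forall j, f j <= tnth k j]%N; last first.
  rewrite negb_forall => /existsP[j]; rewrite -ltnNge => kf.
  rewrite big1// => i _; rewrite [X in X * _ * _](bigD1 j)//=.
  by rewrite nth_default ?size_p// !mul0r.
have [n nf] := multi_surj s_gt0 [tuple (f j : nat) | j < s].
have nN : (n <= N)%N.
  rewrite -(multi_mono s_gt0) nf; apply: grlex_pointwise => j.
  by rewrite tnth_mktuple.
have n_neqN : n != N.
  apply: contra ff0 => /eqP nN_eq; apply/eqP/ffunP => j; apply: val_inj.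
  by have := congr1 (fun t => tnth t j) nf; rewrite tnth_mktuple nN_eq ffunE.
under eq_bigr do rewrite -mulrA.
rewrite -mulr_sumr.
have nN1 : (n < N.+1)%N by [].
rewrite [X in _ * X](_ : _ = VDM P *+ (Ordinal nN1 == ord_max)); last first.
  rewrite -sum_monom_cofactor; apply: eq_bigr => j _; congr (_ * _).
  by apply: eq_bigr => i _; rewrite /= nf tnth_mktuple.
by rewrite -val_eqE /= (negbTE n_neqN) mulr0.
Qed.

Lemma VDM_intertwining (N : nat) (z : 'rV[Cplx R]_s) :
  VDM (fun j : 'I_N.+1 => if (j < N)%N then intertwining eta j else z) =
  newton (multi s N) z * VDM (fun j : 'I_N => intertwining eta j).
Proof.
rewrite -sum_newton_cofactor (bigD1 ord_max)//= ltnn big1 ?addr0 => [|j jN]; last first.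
  have jltN : (j < N)%N by rewrite ltn_neqAle -ltnS ltn_ord andbT.
  by rewrite jltN newton_intertwining ?mul0r.
(* The corner cofactor has sign [(-1)^(N + N)], and its minor involves the first [N] points and
   monomials only. *)
congr (_ * _); rewrite /cofactor addnn -signr_odd odd_double mul1r.
rewrite /VDM; congr (\det _); apply/matrixP => a b; rewrite !mxE !lift_max.
by rewrite ltn_ord.
Qed.

End Intertwining.

(** * The one-variable binary sequence on the unit disc *)

Section BinaryLeja.
Variable R : realType.
Local Notation eta := (binary_leja R).

Definition binary_angle (i : nat) : R :=
  pi * \sum_(l < i.+1) (bit i l)%:R * 2 ^- l.

Lemma binary_lejaE i :
  eta i = (cos (binary_angle i) +i* sin (binary_angle i))%C.
Proof.
rewrite /binary_leja /cexp -/(binary_angle i) /=.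
by simpc; rewrite expR0; simpc.
Qed.

Lemma binary_angle_split i (b : bool) :
  binary_angle (b + 2 * i) = pi * b%:R + binary_angle i / 2.
Proof.
have half : ((b + 2 * i) %/ 2 = i)%N by lia.
rewrite /binary_angle.
(* Both digit sums are padded with zeros; the left range is one longer, to match once its lowest
   digit is split off. *)
rewrite (@sum_extend _ _ (b + 2 * i + i).+2
  (fun l => (bit (b + 2 * i) l)%:R * 2 ^- l)); first last.
- move=> l il; rewrite /bit divn_small ?mul0r//.
  exact: ltn_trans il (ltn_expl _ _).
- by lia.
rewrite (@sum_extend _ i.+1 (b + 2 * i + i).+1
  (fun l => (bit i l)%:R * 2 ^- l)); first last.
- move=> l il; rewrite /bit divn_small ?mul0r//.
  exact: ltn_trans il (ltn_expl _ _).
- by lia.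
rewrite big_ord_recl mulrDr; congr (_ + _).
  by rewrite /bit expn0 divn1 oddD oddM addbF oddb expr0 invr1 mulr1.
rewrite -mulrA; congr (_ * _); rewrite mulr_suml; apply: eq_bigr => l _.
by rewrite /= /bit expnS divnMA half exprS invfM mulrA mulrAC.
Qed.

Lemma binary_leja_double i : eta (2 * i) ^+ 2 = eta i.
Proof.
rewrite !binary_lejaE; have := binary_angle_split i false.
rewrite add0n mulr0 add0r => ->; set x := binary_angle i.
(* This also rewrites the [x] inside [x / 2]; [y] undoes that. *)
have -> : x = x / 2 + x / 2 by lra.
rewrite cosD sinD; set y := (_ + _) / 2.
have -> : y = x / 2 by rewrite /y; lra.
by rewrite expr2; simpc; congr (_ +i* _)%C; ring.
Qed.

Lemma binary_leja_doubleS i : eta (2 * i).+1 = - eta (2 * i).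
Proof.
rewrite !binary_lejaE.
have := binary_angle_split i true; have := binary_angle_split i false.
rewrite add0n mulr0 add0r mulr1 add1n => -> ->.
by rewrite addrC cosDpi sinDpi; simpc.
Qed.

Lemma norm_binary_leja i : `|eta i| = 1.
Proof.
rewrite binary_lejaE normc_def /=.
by rewrite cos2Dsin2 sqrtr1.
Qed.

Definition leja_poly (k : nat) (z : Cplx R) : Cplx R :=
  \prod_(i < k) (z - eta i).

Lemma leja_poly_double m z : leja_poly (2 * m) z = leja_poly m (z ^+ 2).
Proof.
rewrite /leja_poly; elim: m => [|m IH]; first by rewrite !big_ord0.
rewrite mulnS add2n !big_ord_recr /= IH binary_leja_doubleS.
by rewrite -[in RHS]binary_leja_double -mulrA; congr (_ * _); ring.
Qed.

Lemma leja_polyS k z : leja_poly k.+1 z = leja_poly k z * (z - eta k).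
Proof. by rewrite /leja_poly big_ord_recr. Qed.

Lemma leja_poly_max k z : `|z| <= 1 ->
  `|leja_poly k z| <= `|leja_poly k (eta k)|.
Proof.
elim/ltn_ind: k z => k IH z z1; have [-> | k_gt0] := posnP k.
  by rewrite /leja_poly !big_ord0.
have z2 : `|z ^+ 2| <= 1 by rewrite normrX exprn_ile1.
have [m mk [kE|kE]] : exists2 m, (m < k)%N & (k = 2 * m \/ k = (2 * m).+1)%N.
  by exists k./2; lia.
- by rewrite kE !leja_poly_double binary_leja_double IH.
rewrite kE !leja_polyS !leja_poly_double binary_leja_doubleS sqrrN.
rewrite binary_leja_double !normrM ler_pM ?IH//.
(* The extra factor is at most 2 in modulus on the disc, and equals 2 in modulus at the antipode of
   [eta (2 * m)]. *)
rewrite (le_trans (ler_normB _ _))// -opprD normrN -mulr2n normrMn.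
by rewrite norm_binary_leja lerD.
Qed.

End BinaryLeja.

Lemma normr_cabs (R : realType) (x : Cplx R) : `|x| = (cabs x)%:C%C.
Proof. by case: x. Qed.

Lemma le_cabs (R : realType) (x y : Cplx R) :
  (cabs x <= cabs y) = (`|x| <= `|y|).
Proof. by rewrite !normr_cabs lecR. Qed.

Lemma cabs_le1 (R : realType) (x : Cplx R) : (cabs x <= 1) = (`|x| <= 1).
Proof. by rewrite normr_cabs -lecR. Qed.

(** Dilating [z] by [1 + e / 2] stays within distance [e] but leaves the polydisc. *)
Lemma boundary_polydisc (R : realType) (s : nat) (z : 'rV[Cplx R]_s) :
  (0 < s)%N -> (forall j, `|z 0 j| = 1) -> boundary (@closed_polydisc R s) z.
Proof.
move=> s_gt0 z1; split.
  by apply: subset_closure => j; rewrite cabs_le1 z1.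
move=> /nbhs_ballP[e /= e0 zeK].
have e20 : 0 < e / 2 by rewrite divr_gt0.
have /zeK/(_ (Ordinal s_gt0)) : ball z e ((1 + e / 2) *: z).
  split=> // i j; rewrite ord1 mxE -ball_normE /=.
  rewrite mulrDl mul1r opprD addrA subrr add0r normrN normrM z1 mulr1.
  by rewrite gtr0_norm// ltr_pdivrMr// ltr_pMr// ltr1n.
rewrite mxE cabs_le1 normrM z1 mulr1 gtr0_norm ?addr_gt0//.
by rewrite lt_geF ?ltrDl.
Qed.

Theorem corollary1 (R : realType) (s : nat) (hs : (2 <= s)%N) :
  is_leja (@closed_polydisc R s)
    (intertwining (fun _ : 'I_s => binary_leja R)).
Proof.
have s_gt0 : (0 < s)%N by exact: ltnW.
set H := intertwining _.
have normH n j : `|H n 0 j| = 1 by rewrite mxE norm_binary_leja.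
have HK n : closed_polydisc (H n) by move=> j; rewrite cabs_le1 normH.
split=> //; first by exact: boundary_polydisc.
move=> N _.
have -> : VDM (fun j : 'I_N.+1 => H j) =
          VDM (fun j : 'I_N.+1 => if (j < N)%N then H j else H N).
  rewrite /VDM; congr (\det _); apply/matrixP => a b; rewrite !mxE.
  case: ltnP => // Nb; congr (monom _ (H _)); apply/eqP.
  by rewrite eqn_leq Nb -ltnS ltn_ord.
apply/eqP; rewrite eq_le; apply/andP; split.
  by apply: ereal_sup_ubound; exists (H N).
apply: ge_ereal_sup => _ [z zK <-]; rewrite lee_fin.
(* The factor [VDM] of the first [N] points is common to both sides, and [newton] is compared one
   coordinate at a time. *)
rewrite le_cabs !VDM_intertwining// !normrM ler_wpM2r//.
rewrite /newton !normr_prod; apply: ler_prod => j _; rewrite normr_ge0 /=.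
by rewrite [in leRHS]mxE; apply: leja_poly_max; rewrite -cabs_le1; exact: zK.
Qed.
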